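(* Consider the two-dimensional Maxwell--Debye scheme of Young with equal space steps $\delta x=\delta y>0$, in either of the polarisations $(B_x,B_y,E_z)$ or $(B_z,E_x,E_y)$, with $c_\infty,\epsilon_\infty,t_r,\delta t>0$ and $\epsilon_s\ge\epsilon_\infty$. In both polarisations the scheme is stable under the following condition: (i) if $\epsilon_s>\epsilon_\infty$: $\ \delta t\le\min\left(\dfrac{\delta x}{\sqrt2\,c_\infty},\,2t_r\right)$; (ii) if $\epsilon_s=\epsilon_\infty$: $\ \delta t<\dfrac{\delta x}{\sqrt2\,c_\infty}$.
   Context: Put $\lambda=c_\infty\delta t/\delta x$, $\delta=\delta t/(2t_r)$, $\alpha=\epsilon_s/\epsilon_\infty-1$ and, for $\xi=(\xi_x,\xi_y)\in\mathbb R^2$, $\sigma_x=\lambda(e^{i\xi_x}-1)$, $\sigma_y=\lambda(e^{i\xi_y}-1)$; a star denotes complex conjugation. Here $c_\infty$ is the light speed at infinite frequency. The scheme is the Yee (staggered leap-frog) discretization of Maxwell's equations coupled, for each electric component, with Young's discretization of the Debye law for the polarisation $P$; write $b=c_\infty B$, $e=E$, $p=P/(\epsilon_0\epsilon_\infty)$. For plane waves $e^{i(\xi_xj+\xi_yk)}$ (with $B,P$ at time $n-\frac12$ and $E$ at time $n$) the amplitudes evolve by one step, old values without and new values with a superscript $+$, as follows. Polarisation $(B_x,B_y,E_z)$, state $(b_x,b_y,e,p)\in\mathbb C^4$: $b_x^+=b_x-\sigma_ye$, $b_y^+=b_y+\sigma_xe$, $r=\sigma_y^*b_x^+-\sigma_x^*b_y^+$,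 and then $p^+-p=-\delta(p^++p)+2\delta\alpha e$, $e^+-e=r+2\delta p^+-\delta\alpha(e^++e)$. Polarisation $(B_z,E_x,E_y)$, state $(b,e_x,p_x,e_y,p_y)\in\mathbb C^5$: $b^+=b+\sigma_ye_x-\sigma_xe_y$, $r_x=-\sigma_y^*b^+$, $r_y=\sigma_x^*b^+$, and then for each $a\in\{x,y\}$: $p_a^+-p_a=-\delta(p_a^++p_a)+2\delta\alpha e_a$, $e_a^+-e_a=r_a+2\delta p_a^+-\delta\alpha(e_a^++e_a)$. In each polarisation, $G(\xi)$ denotes the matrix of the linear map from old to new state (the amplification matrix). Stability (in the sense of von Neumann) means: for every $\xi\in\mathbb R^2$, the sequence of powers $(G(\xi)^n)_{n\ge0}$ is bounded. *)

(* Defs.v *)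
From mathcomp Require Import all_boot all_order all_algebra.
From mathcomp Require Import complex.
From mathcomp Require Import all_classical all_reals all_analysis.
Set Implicit Arguments.
Unset Strict Implicit.
Unset Printing Implicit Defensive.
Import Order.TTheory GRing.Theory Num.Theory.
Import numFieldNormedType.Exports.
Local Open Scope classical_set_scope.
Local Open Scope ring_scope.
Local Open Scope complex_scope.

Definition expi {R : realType} (x : R) : R[i] := cos x +i* sin x.

Definition sigma {R : realType} (lam x : R) : R[i] := lam%:C * (expi x - 1).

(* Components of a state are numbered from 0; [k] is meant to be at most [n]. *)
Definition comp {R : realType} {n : nat} (u : 'cV[R[i]]_n.+1) (k : nat) : R[i] :=
  u (inord k) 0.

(* Young's update of one electric component and its polarisation, [r] being the
   discrete curl already evaluated at the new magnetic field. The equations are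
   implicit in the new values [e'] and [p']. *)
Definition young_step {R : realType} (delta alpha : R) (r e p e' p' : R[i]) : Prop :=
  p' - p = - delta%:C * (p' + p) + 2 * delta%:C * alpha%:C * e /\
  e' - e = r + 2 * delta%:C * p' - delta%:C * alpha%:C * (e' + e).

(* Polarisation (B_x, B_y, E_z), states (b_x, b_y, e, p). *)
Definition step_BxByEz {R : realType} (lam delta alpha : R) (xi : R * R)
    (u u' : 'cV[R[i]]_4) : Prop :=
  let sx := sigma lam xi.1 in
  let sy := sigma lam xi.2 in
  let bx := comp u 0 in let bx' := comp u' 0 in
  let by_ := comp u 1 in let by' := comp u' 1 in
  let e := comp u 2 in let e' := comp u' 2 in
  let p := comp u 3 in let p' := comp u' 3 in
  let r := sy^* * bx' - sx^* * by' in
  [/\ bx' = bx - sy * e,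
      by' = by_ + sx * e &
      young_step delta alpha r e p e' p'].

(* Polarisation (B_z, E_x, E_y), states (b, e_x, p_x, e_y, p_y). *)
Definition step_BzExEy {R : realType} (lam delta alpha : R) (xi : R * R)
    (u u' : 'cV[R[i]]_5) : Prop :=
  let sx := sigma lam xi.1 in
  let sy := sigma lam xi.2 in
  let b := comp u 0 in let b' := comp u' 0 in
  let ex := comp u 1 in let ex' := comp u' 1 in
  let px := comp u 2 in let px' := comp u' 2 in
  let ey := comp u 3 in let ey' := comp u' 3 in
  let py := comp u 4 in let py' := comp u' 4 in
  let rx := - sy^* * b' in
  let ry := sx^* * b' in
  [/\ b' = b + sy * ex - sx * ey,
      young_step delta alpha rx ex px ex' px' &
      young_step delta alpha ry ey py ey' py'].

(* [G] is the matrix of the linear map from old to new state defined by the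
   implicit relation [step]. *)
Definition amplification_matrix {R : realType} {n : nat}
    (step : 'cV[R[i]]_n -> 'cV[R[i]]_n -> Prop) (G : 'M[R[i]]_n) : Prop :=
  forall u u', step u u' <-> u' = G *m u.

Lemma amplification_matrix_unique {R : realType} {n : nat}
    (step : 'cV[R[i]]_n -> 'cV[R[i]]_n -> Prop) (G G' : 'M[R[i]]_n) :
  amplification_matrix step G -> amplification_matrix step G' -> G = G'.
Proof.
move=> HG HG'; apply/matrixP => i j.
have /HG' : step (delta_mx j 0) (G *m delta_mx j 0) by apply/HG.
by rewrite -!colE => /matrixP/(_ i 0); rewrite !mxE.
Qed.

(* Since the amplification matrix is unique, asking for one with bounded powers
   says that it exists and that its powers are bounded. *)
Definition von_neumann_stable {R : realType} {n : nat}
    (step : R * R -> 'cV[R[i]]_n.+1 -> 'cV[R[i]]_n.+1 -> Prop) : Prop :=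
  forall xi : R * R,
    exists2 G : 'M[R[i]]_n.+1,
      amplification_matrix (step xi) G &
      bounded_set (range (fun k : nat => G ^+ k)).

(* Main.v *)
Require Import Defs.
From mathcomp Require Import all_boot all_order all_algebra.
From mathcomp Require Import complex ring lra.
From mathcomp Require Import all_classical all_reals all_analysis.
Import Order.TTheory GRing.Theory Num.Theory.
Import numFieldNormedType.Exports.
Local Open Scope ring_scope.
Local Open Scope complex_scope.

(** In both polarisations the scheme reads b' = b + K e,
    (1 + delta) p' = (1 - delta) p + 2 delta alpha e and
    e' - e = - K^* b' + 2 delta p' - delta alpha (e' + e),
    where |K v|^2 <= 8 lam^2 |v|^2 for the Hermitian norm.  If alpha > 0, the
    quantity
    W = alpha (|e|^2 + Re <b, b'>) + (1 + delta)/2 |p'|^2 + (1 - delta)/2 |p|^2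
    satisfies W' - W = - (1 - delta^2)/(4 delta) |p'' - p|^2 <= 0, and
    |e|^2 + Re <b, b'> = |b + K e/2|^2 + |e|^2 - |K e|^2/4 is nonnegative when
    2 lam^2 <= 1.  So W bounds p', then e through the equation of the
    polarisation (this covers 2 lam^2 = 1 and delta = 1, where W may degenerate),
    and finally b + K e/2.  If alpha = 0, the polarisation decays geometrically
    and forces a leap-frog scheme whose energy is definite when 2 lam^2 < 1.
    Bounded orbits of the basis vectors give bounded powers. *)

(** * Real inner product on complex vectors, and bounded sequences *)

Section InnerProduct.
Context {R : realType}.
Local Notation C := R[i].

(** The Euclidean product of the underlying real space: symmetric and real-valued, so energies are
    real numbers, but bilinear only over real scalars. *)
Definition dot {n : nat} (x y : 'cV[C]_n) : R :=
  complex.Re (\sum_i x i 0 * (y i 0)^*%R).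

Notation nsq x := (dot x x).

Lemma dotC {n} (x y : 'cV[C]_n) : dot x y = dot y x.
Proof.
rewrite /dot !raddf_sum; apply: eq_bigr => i _.
by case: (x i 0) (y i 0) => [a b] [c d] /=; ring.
Qed.

Lemma dotDl {n} (x y z : 'cV[C]_n) : dot (x + y) z = dot x z + dot y z.
Proof.
rewrite /dot -raddfD -big_split /=; congr complex.Re.
by apply: eq_bigr => i _; rewrite mxE mulrDl.
Qed.

Lemma dotZl {n} (a : R) (x z : 'cV[C]_n) : dot (a%:C *: x) z = a * dot x z.
Proof.
rewrite /dot !raddf_sum mulr_sumr; apply: eq_bigr => i _; rewrite mxE.
by case: (x i 0) (z i 0) => [p q] [c d] /=; ring.
Qed.

Lemma dotNl {n} (x z : 'cV[C]_n) : dot (- x) z = - dot x z.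
Proof.
by rewrite -scaleN1r (_ : -1 = (-1)%:C) ?dotZl ?mulN1r// rmorphN1.
Qed.

Lemma dotDr {n} (x y z : 'cV[C]_n) : dot z (x + y) = dot z x + dot z y.
Proof. by rewrite dotC dotDl !(dotC z). Qed.

Lemma dotZr {n} (a : R) (x z : 'cV[C]_n) : dot z (a%:C *: x) = a * dot z x.
Proof. by rewrite dotC dotZl dotC. Qed.

Lemma dotNr {n} (x z : 'cV[C]_n) : dot z (- x) = - dot z x.
Proof. by rewrite dotC dotNl dotC. Qed.

Definition dotE := (@dotDl, @dotDr, @dotNl, @dotNr, @dotZl, @dotZr).

Lemma dot_ge0 {n} (x : 'cV[C]_n) : 0 <= nsq x.
Proof.
rewrite /dot raddf_sum; apply: sumr_ge0 => i _.
by case: (x i 0) => [a b] /=; nra.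
Qed.

(** Discrete integration by parts: it moves the adjoint curl off the magnetic field in the energy
    balance. *)
Lemma dot_adj {m n} (K : 'M[C]_(m, n)) x y :
  dot ((map_mx Num.conj K)^T *m y) x = dot y (K *m x).
Proof.
rewrite /dot; congr complex.Re.
under eq_bigr do rewrite mxE mulr_suml.
rewrite exchange_big; apply: eq_bigr => i _ /=.
rewrite mxE rmorph_sum mulr_sumr; apply: eq_bigr => j _.
by rewrite !mxE rmorphM; ring.
Qed.

(** Cauchy-Schwarz: expand |a x - b y|^2 >= 0 at a = |y|, b = |x|, then divide by |x| |y|. *)
Lemma dot_le_sqrt {n} (x y : 'cV[C]_n) :
  dot x y <= Num.sqrt (nsq x) * Num.sqrt (nsq y).
Proof.
have hx := dot_ge0 x; have hy := dot_ge0 y.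
have sx := sqr_sqrtr hx; have sy := sqr_sqrtr hy.
have px := sqrtr_ge0 (nsq x); have py := sqrtr_ge0 (nsq y).
set X := Num.sqrt (nsq x) in sx px *; set Y := Num.sqrt (nsq y) in sy py *.
have h : forall a b : R, 2 * a * b * dot x y <= a ^+ 2 * X ^+ 2 + b ^+ 2 * Y ^+ 2.
  move=> a b; have := dot_ge0 (a%:C *: x - b%:C *: y).
  by rewrite !dotE (dotC y x) -sx -sy; lra.
(* A vanishing norm forbids that division; the weights chosen in these two cases force [dot x y] to
   be 0. *)
have [Xz|X0] := eqVneq X 0; last have [Yz|Y0] := eqVneq Y 0.
- have := h (Y ^+ 2 + 1) (dot x y); rewrite Xz; nra.
- have := h (dot x y) (X ^+ 2 + 1); rewrite Yz; nra.
have XY : 0 < X * Y by rewrite mulr_gt0// lt0r ?X0 ?Y0.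
rewrite -(ler_pM2l XY); have := h Y X; lra.
Qed.

Definition bdd_seq {n} (x : nat -> 'cV[C]_n) := exists M, forall k, nsq (x k) <= M.

Lemma bdd_seqD {n} (x y : nat -> 'cV[C]_n) :
  bdd_seq x -> bdd_seq y -> bdd_seq (fun k => x k + y k).
Proof.
move=> [M hM] [N hN]; exists (2 * M + 2 * N) => k.
have := dot_ge0 (x k - y k); have := hM k; have := hN k.
by rewrite !dotE; lra.
Qed.

Lemma bdd_seqZ {n} (a : R) (x : nat -> 'cV[C]_n) :
  bdd_seq x -> bdd_seq (fun k => a%:C *: x k).
Proof.
move=> [M hM]; exists (a ^+ 2 * M) => k; rewrite !dotE mulrA -expr2.
by rewrite ler_wpM2l ?sqr_ge0.
Qed.

Lemma bdd_seqS {n} (x : nat -> 'cV[C]_n) :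
  bdd_seq (fun k => x k.+1) -> bdd_seq x.
Proof.
move=> [M hM]; exists (Num.max (nsq (x 0)) M) => -[|k].
  by rewrite le_max lexx.
by rewrite le_max hM orbT.
Qed.

(** * Energy estimates for the abstract scheme with curl matrix [K] *)

Section Scheme.
Variables (m n : nat) (K : 'M[C]_(m, n)) (s delta alpha : R).
Variables (b : nat -> 'cV[C]_m) (e p : nat -> 'cV[C]_n).
Hypothesis K_le : forall x, nsq (K *m x) <= s * nsq x.
Hypothesis delta_gt0 : 0 < delta.
Hypothesis bS : forall k, b k.+1 = b k + K *m e k.
Hypothesis pS : forall k,
  (1 + delta)%:C *: p k.+1 = (1 - delta)%:C *: p k + (2 * delta * alpha)%:C *: e k.
Hypothesis eS : forall k, e k.+1 - e k = (2 * delta)%:C *: p k.+1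
  - (delta * alpha)%:C *: (e k.+1 + e k) - (map_mx Num.conj K)^T *m b k.+1.

(** The leap-frog energy: the magnetic part pairs the two half time levels that surround the time of
    [e k]. *)
Definition em_energy k := nsq (e k) + dot (b k) (b k.+1).

Lemma em_energyE k :
  em_energy k = nsq (b k + 2^-1%:C *: (K *m e k)) + (nsq (e k) - nsq (K *m e k) / 4).
Proof. by rewrite /em_energy bS !dotE (dotC (K *m e k) (b k)); field. Qed.

Lemma em_energy_ge k :
  nsq (b k + 2^-1%:C *: (K *m e k)) + (1 - s / 4) * nsq (e k) <= em_energy k.
Proof. by rewrite em_energyE; have := K_le (e k); lra. Qed.

(** Pair the electric equation with [e k.+1 + e k]. Since [K] maps this sum to [b k.+2 - b k], the
    curl term is exactly the change of the magnetic part. *)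
Lemma em_energyS k : em_energy k.+1 - em_energy k =
  2 * delta * dot (p k.+1) (e k.+1 + e k) - delta * alpha * nsq (e k.+1 + e k).
Proof.
have := dot_adj K (e k.+1 + e k) (b k.+1).
rewrite mulmxDr (_ : K *m e k.+1 + K *m e k = b k.+2 - b k); last first.
  by rewrite (bS k.+1) (bS k) addrAC [b k + _]addrC addrK addrC.
have := congr1 (dot (e k.+1 + e k)) (eS k).
rewrite /em_energy; set y := _ *m b k.+1; rewrite !dotE (dotC _ y) (dotC _ y).
rewrite (dotC (e k) (e k.+1)) (dotC (b k) (b k.+1)) (dotC (e k)) (dotC (e k.+1) (p _)); lra.
Qed.

(** The energy controls only b + K e/2; the bound on [e] allows K e/2 to be subtracted. *)
Lemma bdd_seq_b : s <= 4 -> (exists M, forall k, em_energy k <= M) ->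
  bdd_seq e -> bdd_seq b.
Proof.
move=> s_le4 [M hM] [N hN].
have c_ge0 : 0 <= 1 - s / 4 by lra.
have Ke_bdd : bdd_seq (fun k => K *m e k).
  exists (4 * N) => k; apply: le_trans (K_le _) _.
  by have := hN k; have := mulr_ge0 c_ge0 (dot_ge0 (e k)); lra.
have bKe_bdd : bdd_seq (fun k => b k + 2^-1%:C *: (K *m e k)).
  exists M => k; apply: le_trans (hM k).
  by have := em_energy_ge k; have := mulr_ge0 c_ge0 (dot_ge0 (e k)); lra.
have [B hB] := bdd_seqD _ _ bKe_bdd (bdd_seqZ (- 2^-1) _ Ke_bdd).
by exists B => k; have := hB k; rewrite rmorphN scaleNr addrK.
Qed.

Definition energy k := alpha * em_energy k
  + (1 + delta) / 2 * nsq (p k.+1) + (1 - delta) / 2 * nsq (p k).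

(** Adding two consecutive polarisation equations expresses e' + e by p, p', p''. Then alpha times
    the electromagnetic balance is delta |p'|^2 - |(1 + delta) p'' - (1 - delta) p|^2 / (4 delta);
    the |p'|^2 terms cancel in the total, leaving a multiple of |p'' - p|^2. *)
Lemma energy_le k : delta <= 1 -> energy k.+1 <= energy k.
Proof.
move=> delta_le1; have qE : (2 * delta * alpha)%:C *: (e k.+1 + e k) = (1 + delta)%:C *: p k.+2
    + (2 * delta)%:C *: p k.+1 - (1 - delta)%:C *: p k.
  apply: (addrI ((1 - delta)%:C *: (p k.+1 + p k))).
  rewrite [RHS]addrCA scalerDr.
  rewrite scalerDr addrACA -!pS; apply/matrixP => i j; rewrite !mxE.
  rewrite !(rmorphD, rmorphN, rmorphM, rmorph1) /=; ring.
move: qE (em_energyS k); set q := e k.+1 + e k; move: q => q qE hE.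
have := congr1 (dot (p k.+1)) qE; have := congr1 (fun v => dot v v) qE.
have := dot_ge0 (p k.+2 - p k); rewrite /energy !dotE.
rewrite (dotC (p k) (p k.+1)) (dotC (p k) (p k.+2)) (dotC (p k.+1) (p k.+2)).
move=> hD hB hA.
have d1 : 0 <= (1 - delta ^+ 2) / 4.
  by rewrite divr_ge0// subr_ge0 expr_le1// ltW.
have {d1}hD := mulr_ge0 d1 hD.
have -> : em_energy k.+1 = em_energy k
    + (2 * delta * dot (p k.+1) q - delta * alpha * nsq q) by lra.
(* After multiplication by [4 * delta], [q] enters the goal only through the left-hand sides of
   [hA4] and [hB]. *)
have hA4 := congr1 ( *%R (4 * delta)) hA.
have d4 : 0 < 4 * delta by rewrite mulr_gt0.
rewrite -(ler_pM2l d4); lra.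
Qed.

Lemma energy_bound : 0 < alpha -> s <= 4 -> delta <= 1 ->
  [/\ bdd_seq b, bdd_seq e & bdd_seq p].
Proof.
move=> alpha_gt0 s_le4 delta_le1.
have energy_le0 k : energy k <= energy 0.
  by elim: k => // k; apply: le_trans; exact: energy_le.
have em_ge0 k : 0 <= em_energy k.
  apply: le_trans (em_energy_ge k).
  by rewrite addr_ge0 ?dot_ge0// mulr_ge0 ?dot_ge0//; lra.
have p_ge0 k : 0 <= (1 - delta) / 2 * nsq (p k).
  by rewrite mulr_ge0 ?dot_ge0//; lra.
have pS_ge0 k : 0 <= (1 + delta) / 2 * nsq (p k.+1).
  by rewrite mulr_ge0 ?dot_ge0// divr_ge0// addr_ge0// ltW.
have p_bdd : bdd_seq p.
  (* The weight of [p k] vanishes at delta = 1, whereas that of [p k.+1] is at least 1/2; hence the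
     shift and the factor 2. *)
  apply: bdd_seqS; exists (energy 0 * 2) => k.
  have := energy_le0 k; rewrite /energy /=.
  have := mulr_ge0 (ltW alpha_gt0) (em_ge0 k).
  have := p_ge0 k; have := mulr_ge0 (ltW delta_gt0) (dot_ge0 (p k.+1)); lra.
have da_gt0 : 0 < 2 * delta * alpha by rewrite !mulr_gt0.
have e_bdd : bdd_seq e.
  have [M hM] : bdd_seq (fun k => (2 * delta * alpha)^-1%:C *:
      ((1 + delta)%:C *: p k.+1 + (- (1 - delta))%:C *: p k)).
    apply/bdd_seqZ/bdd_seqD; apply: bdd_seqZ => //.
    by have [M hM] := p_bdd; exists M => k; exact: hM.
  exists M => k; have := hM k; rewrite rmorphN scaleNr pS addrAC subrr add0r.
  by rewrite scalerA -rmorphM mulVf ?gt_eqF// scale1r.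
split=> //; apply: bdd_seq_b => //; exists (energy 0 / alpha) => k.
rewrite ler_pdivlMr// mulrC; apply: le_trans (energy_le0 k).
by rewrite /energy; have := p_ge0 k; have := pS_ge0 k; lra.
Qed.

(* With P the norm of p, sqrt em_energy + L P is nonincreasing for a suitable L. *)
Lemma decoupled_bound : alpha = 0 -> s < 4 ->
  [/\ bdd_seq b, bdd_seq e & bdd_seq p].
Proof.
move=> alpha0 s_lt4; pose rho := (1 - delta) / (1 + delta).
have pS' k : p k.+1 = rho%:C *: p k.
  have := congr1 (fun v => (1 + delta)^-1%:C *: v) (pS k).
  rewrite alpha0 mulr0 scale0r addr0 !scalerA -!rmorphM /= mulVf ?scale1r.
    by rewrite mulrC.
  by rewrite gt_eqF// addr_gt0.
have rho_lt1 : `|rho| < 1.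
  have d1 : 0 < 1 + delta by rewrite addr_gt0.
  rewrite ltr_norml /rho ltr_pdivlMr// ltr_pdivrMr//.
  by apply/andP; split; have := delta_gt0; lra.
pose P k := Num.sqrt (nsq (p k)); pose E k := Num.sqrt (em_energy k).
have PS k : P k.+1 = `|rho| * P k.
  by rewrite /P pS' !dotE mulrA -expr2 sqrtrM ?sqr_ge0// sqrtr_sqr.
have P_ge0 k : 0 <= P k by exact: sqrtr_ge0.
have E_ge0 k : 0 <= E k by exact: sqrtr_ge0.
pose c := 1 - s / 4; have c_gt0 : 0 < c by rewrite /c; lra.
have e_le k : c * nsq (e k) <= em_energy k.
  by have := em_energy_ge k; have := dot_ge0 (b k + 2^-1%:C *: (K *m e k)); rewrite /c; lra.
have em_ge0 k : 0 <= em_energy k.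
  by apply: le_trans (e_le k); rewrite mulr_ge0 ?dot_ge0// ltW.
have EE k : E k ^+ 2 = em_energy k by rewrite sqr_sqrtr.
pose d := Num.sqrt c; have d_gt0 : 0 < d by rewrite sqrtr_gt0.
have sqrt_e_le k : Num.sqrt (nsq (e k)) <= E k / d.
  rewrite ler_pdivlMr// mulrC -sqrtrM ?(ltW c_gt0)//.
  exact: ler_wsqrtr.
(* Factor the energy increment as (E' - E)(E' + E) and bound it by Cauchy-Schwarz and |e| <= E/d;
   the common factor E' + E cancels. It is positive once the trivial case E' <= E is set aside. *)
have E_le k : E k.+1 <= E k + 2 * delta / d * P k.+1.
  have [|lt_E] := leP (E k.+1) (E k).
    by move/le_trans; apply; rewrite lerDl mulr_ge0// divr_ge0 ?ltW// mulr_gt0.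
  have E_gt0 : 0 < E k.+1 + E k by have := E_ge0 k; lra.
  rewrite -lerBlDl -(ler_pM2r E_gt0).
  have -> : (E k.+1 - E k) * (E k.+1 + E k) = em_energy k.+1 - em_energy k.
    by rewrite -!EE; ring.
  rewrite em_energyS alpha0 mulr0 mul0r subr0 dotDr.
  have le1 := le_trans (dot_le_sqrt (p k.+1) (e k.+1))
                (ler_wpM2l (P_ge0 k.+1) (sqrt_e_le k.+1)).
  have le2 := le_trans (dot_le_sqrt (p k.+1) (e k))
                (ler_wpM2l (P_ge0 k.+1) (sqrt_e_le k)).
  have -> : 2 * delta / d * P k.+1 * (E k.+1 + E k) =
      2 * delta * (P k.+1 * (E k.+1 / d) + P k.+1 * (E k / d)) by ring.
  by rewrite ler_wpM2l ?lerD// mulr_ge0// ltW.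
(* With this [L] the growth of E is at most L (1 - |rho|) P', and P' = |rho| P, so E + L P changes
   by at most - L P (1 - |rho|)^2. *)
pose L := 2 * delta / d / (1 - `|rho|).
have L_ge0 : 0 <= L.
  by rewrite divr_ge0 ?subr_ge0 ?(ltW rho_lt1)// divr_ge0 ?(ltW d_gt0)// mulr_ge0// ltW.
have LE : L * (1 - `|rho|) = 2 * delta / d by rewrite divfK// gt_eqF// subr_gt0.
have V_le k : E k + L * P k <= E 0 + L * P 0.
  elim: k => // k; apply: le_trans; have := E_le k; rewrite -LE.
  move=> /le_trans h; rewrite -lerBrDr; apply: h.
  rewrite PS; have := mulr_ge0 (mulr_ge0 L_ge0 (P_ge0 k)) (sqr_ge0 (1 - `|rho|)); lra.
have em_le k : em_energy k <= (E 0 + L * P 0) ^+ 2.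
  have V_ge0 j : 0 <= E j + L * P j by rewrite addr_ge0// mulr_ge0.
  rewrite -EE ler_sqr ?nnegrE//.
  by apply: le_trans (V_le k); rewrite lerDl mulr_ge0.
have e_bdd : bdd_seq e.
  exists ((E 0 + L * P 0) ^+ 2 / c) => k.
  by rewrite ler_pdivlMr// mulrC; exact: le_trans (e_le k) (em_le k).
split=> //.
  by apply: bdd_seq_b; [exact: ltW | exists ((E 0 + L * P 0) ^+ 2) | ].
exists (nsq (p 0)); elim=> // k; apply: le_trans.
rewrite pS' !dotE mulrA -[leRHS]mul1r ler_wpM2r ?dot_ge0// -expr2 -real_normK ?num_real//.
by rewrite expr_le1// ltW.
Qed.
End Scheme.
End InnerProduct.

(** * From bounded orbits to bounded powers; solving Young's equations; symbol bounds *)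

Section Stability.
Context {R : realType}.
Local Notation C := R[i].
Local Notation nsq x := (dot x x).

Definition sqnormc (z : C) : R := complex.Re z ^+ 2 + complex.Im z ^+ 2.

Lemma nsqE {n} (x : 'cV[C]_n) : nsq x = \sum_i sqnormc (x i 0).
Proof.
rewrite /dot raddf_sum; apply: eq_bigr => i _; rewrite /sqnormc.
by case: (x i 0) => [a b] /=; ring.
Qed.

Lemma sqnormc_ge0 z : 0 <= sqnormc z.
Proof. by rewrite addr_ge0 ?sqr_ge0. Qed.

Lemma normc_le_nsq {n} (x : 'cV[C]_n) i : `|x i 0| <= (Num.sqrt (nsq x))%:C.
Proof.
rewrite normc_def lecR ler_wsqrtr// nsqE (bigD1 i)//= -/(sqnormc _) lerDl.
by apply: sumr_ge0 => j _; exact: sqnormc_ge0.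
Qed.

(** Column j of [G ^+ k] is the orbit of the j-th basis vector. Summing the finitely many column
    bounds gives one bound for all entries. *)
Lemma bounded_powers {n} (G : 'M[C]_n.+1) :
  (forall u : 'cV_n.+1, bdd_seq (fun k => G ^+ k *m u)) ->
  bounded_set (range (fun k : nat => G ^+ k)).
Proof.
move=> orbit.
have [M hM] := choice (fun j : 'I_n.+1 => orbit (delta_mx j 0)).
pose B := \sum_j Num.sqrt (M j).
have B_ge0 : 0 <= B by apply: sumr_ge0 => j _; exact: sqrtr_ge0.
exists B%:C; split; first by rewrite complex_real.
move=> x Bx _ [k _ <-] /=; apply: le_trans (ltW Bx).
change (mx_norm (G ^+ k) <= B%:C).
(* A nonzero matrix norm is attained as the modulus of some entry. *)
have [->|] := eqVneq (mx_norm (G ^+ k)) 0; first by rewrite ler0c.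
move=> /mx_norm_neq0[[i j] ->] /=.
have -> : (G ^+ k) i j = (G ^+ k *m delta_mx j (0 : 'I_1)) i 0.
  by rewrite -colE mxE.
apply: le_trans (normc_le_nsq _ _) _; rewrite lecR.
apply: (@le_trans _ _ (Num.sqrt (M j))); first exact/ler_wsqrtr/hM.
rewrite /B (bigD1 j)//= lerDl; apply: sumr_ge0 => l _; exact: sqrtr_ge0.
Qed.

(** Reduces stability to an explicit linear solution [f] of the implicit step and a bound on each
    orbit; the columns of [G] are the images of the basis vectors. *)
Lemma stable_of_linear {n} (step : 'cV[C]_n.+1 -> 'cV[C]_n.+1 -> Prop) f :
  (forall u u', step u u' <-> u' = f u) ->
  (forall a u v, f (a *: u + v) = a *: f u + f v) ->
  (forall x, (forall k, step (x k) (x k.+1)) -> bdd_seq x) ->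
  exists2 G : 'M[C]_n.+1, amplification_matrix step G &
    bounded_set (range (fun k : nat => G ^+ k)).
Proof.
move=> stepE flin orbit.
have f0 : f 0 = 0.
  have := flin 1 0 0; rewrite !scale1r addr0 => h.
  by apply: (addrI (f 0)); rewrite addr0 -h.
have fD u v : f (u + v) = f u + f v by have := flin 1 u v; rewrite !scale1r.
have fZ a u : f (a *: u) = a *: f u by have := flin a u 0; rewrite !addr0 f0 addr0.
pose G := \matrix_(i, j) f (delta_mx j 0) i 0.
have GE u : G *m u = f u.
  rewrite [in RHS](matrix_sum_delta u) (big_morph f fD f0).
  apply/colP => i; rewrite summxE mxE; apply: eq_bigr => j _.
  by rewrite big_ord1 fZ !mxE mulrC.
exists G; first by move=> u u'; rewrite GE.
apply: bounded_powers => u; apply: orbit => k.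
by rewrite stepE -GE mulmxA exprS.
Qed.

(** Young's system is triangular: the equation for p' does not involve e', so p' is found first and
    then inserted into the equation for e'. *)
Definition young_p (delta alpha : R) (e p : C) : C :=
  (1 + delta)^-1%:C * ((1 - delta)%:C * p + (2 * delta * alpha)%:C * e).

Definition young_e (delta alpha : R) (r e p : C) : C :=
  (1 + delta * alpha)^-1%:C * ((1 - delta * alpha)%:C * e + r
    + (2 * delta)%:C * young_p delta alpha e p).

(** The two pivots 1 + delta and 1 + delta alpha are positive, so the system has exactly one
    solution. *)
Lemma young_stepP (delta alpha : R) r e p e' p' : 0 < delta -> 0 <= alpha ->
  young_step delta alpha r e p e' p' <->
  e' = young_e delta alpha r e p /\ p' = young_p delta alpha e p.
Proof.
move=> delta_gt0 alpha_ge0.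
have nz1 : (1 + delta)%:C != 0 :> C.
  by rewrite fmorph_eq0 gt_eqF// addr_gt0.
have nz2 : (1 + delta * alpha)%:C != 0 :> C.
  by rewrite fmorph_eq0 gt_eqF// ltr_wpDr// mulr_ge0// ltW.
rewrite /young_step /young_e; set P := young_p _ _ _ _.
have PE x : x - p = - delta%:C * (x + p) + 2 * delta%:C * alpha%:C * e <-> x = P.
  rewrite /P /young_p; move: nz1.
  rewrite fmorphV !(rmorphD, rmorphN, rmorphM, rmorph1, rmorph_nat) /= => nz1.
  split => [h|->]; last by field.
  by apply: (mulfI nz1); rewrite mulVKf//; apply/eqP; rewrite -subr_eq0; apply/eqP;
     move/eqP: h; rewrite -subr_eq0 => /eqP <-; ring.
have EE x : x - e = r + 2 * delta%:C * P - delta%:C * alpha%:C * (x + e) <->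
    x = (1 + delta * alpha)^-1%:C * ((1 - delta * alpha)%:C * e + r + (2 * delta)%:C * P).
  move: nz2.
  rewrite fmorphV !(rmorphD, rmorphN, rmorphM, rmorph1, rmorph_nat) /= => nz2.
  split => [h|->]; last by field.
  by apply: (mulfI nz2); rewrite mulVKf//; apply/eqP; rewrite -subr_eq0; apply/eqP;
     move/eqP: h; rewrite -subr_eq0 => /eqP <-; ring.
split=> [[/PE -> /EE ->]|[-> ->]] //.
by split; [exact/PE | exact/EE].
Qed.

(** Turns coordinatewise Young equations into the vector recurrences of the abstract scheme; the two
    alternatives select [energy_bound] or [decoupled_bound]. *)
Lemma young_scheme_bdd {m n} (K : 'M[C]_(m, n)) (s delta alpha : R)
    (b : nat -> 'cV[C]_m) (e p : nat -> 'cV[C]_n) :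
  (forall x, nsq (K *m x) <= s * nsq x) -> 0 < delta ->
  (0 < alpha /\ s <= 4 /\ delta <= 1) \/ (alpha = 0 /\ s < 4) ->
  (forall k, b k.+1 = b k + K *m e k) ->
  (forall k i, young_step delta alpha (- ((map_mx Num.conj K)^T *m b k.+1) i 0)
     (e k i 0) (p k i 0) (e k.+1 i 0) (p k.+1 i 0)) ->
  [/\ bdd_seq b, bdd_seq e & bdd_seq p].
Proof.
move=> K_le delta_gt0 cond bS young.
have pS k : (1 + delta)%:C *: p k.+1 =
    (1 - delta)%:C *: p k + (2 * delta * alpha)%:C *: e k.
  apply/colP => i; rewrite !mxE; have [/eqP h _] := young k i.
  apply/eqP; rewrite -subr_eq0; apply/eqP; move: h; rewrite -subr_eq0 => /eqP <-.
  by rewrite !(rmorphD, rmorphN, rmorphM, rmorph1, rmorph_nat) /=; ring.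
have eS k : e k.+1 - e k = (2 * delta)%:C *: p k.+1
    - (delta * alpha)%:C *: (e k.+1 + e k) - (map_mx Num.conj K)^T *m b k.+1.
  apply/colP => i; move: (young k i); move: (_ *m b k.+1) => y [_ /eqP h].
  rewrite !mxE.
  apply/eqP; rewrite -subr_eq0; apply/eqP; move: h; rewrite -subr_eq0 => /eqP <-.
  by rewrite !(rmorphD, rmorphN, rmorphM, rmorph1, rmorph_nat) /=; ring.
case: cond => [[alpha_gt0 [s_le4 delta_le1]]|[alpha0 s_lt4]].
- exact: (energy_bound _ _ K s delta alpha).
- exact: (decoupled_bound _ _ K s delta alpha).
Qed.

(** |exp(i x) - 1|^2 = 2 - 2 cos x is at most 4. *)
Lemma sqnormc_sigma_le (lam x : R) : sqnormc (sigma lam x) <= 4 * lam ^+ 2.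
Proof.
have -> : sqnormc (sigma lam x) = lam ^+ 2 * (1 + (cos x ^+ 2 + sin x ^+ 2) - 2 * cos x).
  by rewrite /sqnormc /sigma /expi /=; ring.
rewrite cos2Dsin2 mulrC ler_wpM2r ?sqr_ge0//.
by have := cos_geN1 x; lra.
Qed.

Lemma sqnormcM (z w : C) : sqnormc (z * w) = sqnormc z * sqnormc w.
Proof. by case: z w => [a b] [c d]; rewrite /sqnormc /=; ring. Qed.

(** Lagrange's identity: the defect is the squared modulus of w^* x + z^* y. *)
Lemma sqnormcB_le (z w x y : C) : sqnormc (z * x - w * y) <=
  (sqnormc z + sqnormc w) * (sqnormc x + sqnormc y).
Proof.
case: z w x y => [a b] [c d] [f g] [h i]; rewrite -subr_ge0.
rewrite (_ : _ - _ = sqnormc ((c -i* d) * (f +i* g) + (a -i* b) * (h +i* i))).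
  exact: sqnormc_ge0.
by rewrite /sqnormc /=; ring.
Qed.

Lemma comp_col {n} (F : nat -> C) k : (k < n.+1)%N ->
  Defs.comp (\col_(i < n.+1) F i) k = F k.
Proof. by move=> kn; rewrite /Defs.comp mxE inordK. Qed.

Lemma eq_compP {n} (u v : 'cV[C]_n.+1) :
  (forall k, (k < n.+1)%N -> Defs.comp u k = Defs.comp v k) <-> u = v.
Proof.
split=> [h|-> //]; apply/colP => i.
by have := h i (ltn_ord i); rewrite /Defs.comp inord_val.
Qed.

Lemma comp_lin {n} a (u v : 'cV[C]_n.+1) k :
  Defs.comp (a *: u + v) k = a * Defs.comp u k + Defs.comp v k.
Proof. by rewrite /Defs.comp !mxE. Qed.

Lemma nsq_comp {n} (u : 'cV[C]_n.+1) : nsq u = \sum_(i < n.+1) sqnormc (Defs.comp u i).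
Proof. by rewrite nsqE; apply: eq_bigr => i _; rewrite /Defs.comp inord_val. Qed.
End Stability.

(** * The two polarisations as instances of the abstract scheme *)

Section Polarisations.
Context {R : realType}.
Local Notation C := R[i].
Local Notation nsq x := (dot x x).
Variables (lam delta alpha : R).
Hypothesis delta_gt0 : 0 < delta.
Hypothesis alpha_ge0 : 0 <= alpha.
Hypothesis cond : (0 < alpha /\ 8 * lam ^+ 2 <= 4 /\ delta <= 1) \/
  (alpha = 0 /\ 8 * lam ^+ 2 < 4).

(** The left side dominates the squared norm of [K] in both polarisations, so [8 * lam ^+ 2] can
    serve as [s]. *)
Lemma sqnormc_sigmaD_le (xi : R * R) :
  sqnormc (sigma lam xi.1) + sqnormc (sigma lam xi.2) <= 8 * lam ^+ 2.
Proof. by have := sqnormc_sigma_le lam xi.1; have := sqnormc_sigma_le lam xi.2; lra. Qed.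

(** The local [bx] and [by_] are already the new values, so [r] is the curl of the updated field. *)
Definition next_BxByEz (xi : R * R) (u : 'cV[C]_4) : 'cV[C]_4 :=
  let sx := sigma lam xi.1 in let sy := sigma lam xi.2 in
  let e := Defs.comp u 2 in let p := Defs.comp u 3 in
  let bx := Defs.comp u 0 - sy * e in
  let by_ := Defs.comp u 1 + sx * e in
  let r := sy^*%R * bx - sx^*%R * by_ in
  \col_(i < 4) [:: bx; by_; young_e delta alpha r e p; young_p delta alpha e p]`_i.

Lemma step_BxByEzE xi u u' :
  step_BxByEz lam delta alpha xi u u' <-> u' = next_BxByEz xi u.
Proof.
split=> [[hx hy /(young_stepP _ _ _ _ _ _ _ delta_gt0 alpha_ge0)[he hp]]|->].
  apply/eq_compP => -[|[|[|[|k]]]] // _; rewrite comp_col//=.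
  - by rewrite he hx hy.
split; rewrite ?comp_col//.
by apply/(young_stepP _ _ _ _ _ _ _ delta_gt0 alpha_ge0).
Qed.

Lemma next_BxByEz_lin xi a u v :
  next_BxByEz xi (a *: u + v) = a *: next_BxByEz xi u + next_BxByEz xi v.
Proof.
apply/colP => i; rewrite /next_BxByEz !mxE !comp_lin /young_e /young_p.
by case: i => -[|[|[|[|k]]]] //= _; ring.
Qed.

Lemma stable_BxByEz : von_neumann_stable (step_BxByEz lam delta alpha).
Proof.
move=> xi; apply: (stable_of_linear _ (next_BxByEz xi)).
- exact: step_BxByEzE.
- exact: next_BxByEz_lin.
move=> x hx; pose sx := sigma lam xi.1; pose sy := sigma lam xi.2.
(* Signs chosen so that b' = b + K e and - K^* b' is the curl [r]. *)
pose K : 'M[C]_(2, 1) := \matrix_(i, j) [:: - sy; sx]`_i.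
pose b k : 'cV[C]_2 := \col_i Defs.comp (x k) i.
pose e k : 'cV[C]_1 := \col_i Defs.comp (x k) 2.
pose p k : 'cV[C]_1 := \col_i Defs.comp (x k) 3.
have [v|k|k i|[Mb hb] [Me he] [Mp hp]] :=
    young_scheme_bdd K (8 * lam ^+ 2) _ _ b e p _ delta_gt0 cond.
- apply: le_trans (ler_wpM2r (dot_ge0 v) (sqnormc_sigmaD_le xi)).
  rewrite !nsqE !big_ord_recl !big_ord0 !mxE !big_ord1 !mxE /=.
  rewrite !addr0 !sqnormcM /sqnormc /=; lra.
- have [hbx hby _] := hx k; apply/colP => -[[|[|i]] hi] //=;
    by rewrite !mxE big_ord1 !mxE /= ?hbx ?hby ?mulNr.
- have [_ _] := hx k; rewrite !mxE !big_ord_recl big_ord0 !mxE /=.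
  congr young_step; rewrite rmorphN; ring.
exists (Mb + (Me + Mp)) => k.
(* The squared norm of the state is the sum of those of its three blocks. *)
apply: le_trans (lerD (hb k) (lerD (he k) (hp k))).
rewrite (nsq_comp (x k)) !nsqE !big_ord_recl !big_ord0 !mxE /=; lra.
Qed.

Definition next_BzExEy (xi : R * R) (u : 'cV[C]_5) : 'cV[C]_5 :=
  let sx := sigma lam xi.1 in let sy := sigma lam xi.2 in
  let ex := Defs.comp u 1 in let px := Defs.comp u 2 in
  let ey := Defs.comp u 3 in let py := Defs.comp u 4 in
  let b := Defs.comp u 0 + sy * ex - sx * ey in
  let rx := - sy^*%R * b in let ry := sx^*%R * b in
  \col_(i < 5) [:: b; young_e delta alpha rx ex px; young_p delta alpha ex px;
                   young_e delta alpha ry ey py; young_p delta alpha ey py]`_i.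

Lemma step_BzExEyE xi u u' :
  step_BzExEy lam delta alpha xi u u' <-> u' = next_BzExEy xi u.
Proof.
split=> [[hb /(young_stepP _ _ _ _ _ _ _ delta_gt0 alpha_ge0)[hex hpx]
             /(young_stepP _ _ _ _ _ _ _ delta_gt0 alpha_ge0)[hey hpy]]|->].
  apply/eq_compP => -[|[|[|[|[|k]]]]] // _; rewrite comp_col//=.
  - by rewrite hex hb.
  - by rewrite hey hb.
split; rewrite ?comp_col//;
  by apply/(young_stepP _ _ _ _ _ _ _ delta_gt0 alpha_ge0).
Qed.

Lemma next_BzExEy_lin xi a u v :
  next_BzExEy xi (a *: u + v) = a *: next_BzExEy xi u + next_BzExEy xi v.
Proof.
apply/colP => i; rewrite /next_BzExEy !mxE !comp_lin /young_e /young_p.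
by case: i => -[|[|[|[|[|k]]]]] //= _; ring.
Qed.

Lemma stable_BzExEy : von_neumann_stable (step_BzExEy lam delta alpha).
Proof.
move=> xi; apply: (stable_of_linear _ (next_BzExEy xi)).
- exact: step_BzExEyE.
- exact: next_BzExEy_lin.
move=> x hx; pose sx := sigma lam xi.1; pose sy := sigma lam xi.2.
(* Here - K^* b' has coordinates [rx] and [ry]; [e] and [p] regroup the interleaved state. *)
pose K : 'M[C]_(1, 2) := \matrix_(i, j) [:: sy; - sx]`_j.
pose b k : 'cV[C]_1 := \col_i Defs.comp (x k) 0.
pose e k : 'cV[C]_2 := \col_i [:: Defs.comp (x k) 1; Defs.comp (x k) 3]`_i.
pose p k : 'cV[C]_2 := \col_i [:: Defs.comp (x k) 2; Defs.comp (x k) 4]`_i.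
have [v|k|k i|[Mb hb] [Me he] [Mp hp]] :=
    young_scheme_bdd K (8 * lam ^+ 2) _ _ b e p _ delta_gt0 cond.
- apply: le_trans (ler_wpM2r (dot_ge0 v) (sqnormc_sigmaD_le xi)).
  rewrite !nsqE !big_ord_recl !big_ord0 !mxE !big_ord_recl big_ord0 !mxE /=.
  (* [K] is now a row, so its norm bound needs Cauchy-Schwarz instead of a direct expansion. *)
  by rewrite !addr0 mulNr [leRHS]mulrC -/sx -/sy (addrC (sqnormc sx)) mulrC sqnormcB_le.
- have [hb _ _] := hx k; apply/colP => i.
  by rewrite !mxE !big_ord_recl big_ord0 !mxE /= hb -/sx -/sy; ring.
- have [_ hex hey] := hx k; rewrite !mxE !big_ord_recl big_ord0 !mxE /= addr0.
  case: i => -[|[|i]] //= hi; [move: hex | move: hey]; congr young_step.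
  + by rewrite mulNr.
  + by rewrite rmorphN mulNr opprK.
exists (Mb + (Me + Mp)) => k.
apply: le_trans (lerD (hb k) (lerD (he k) (hp k))).
rewrite (nsq_comp (x k)) !nsqE !big_ord_recl !big_ord0 !mxE /=; lra.
Qed.
End Polarisations.

Theorem mainTheorem10 (R : realType)
    (c_inf eps_inf eps_s t_r dt dx : R)
    (c_inf_gt0 : 0 < c_inf) (eps_inf_gt0 : 0 < eps_inf) (t_r_gt0 : 0 < t_r)
    (dt_gt0 : 0 < dt) (dx_gt0 : 0 < dx) (eps_le : eps_inf <= eps_s)
    (cond_i : eps_inf < eps_s ->
       dt <= Num.min (dx / (Num.sqrt 2 * c_inf)) (2 * t_r))
    (cond_ii : eps_s = eps_inf -> dt < dx / (Num.sqrt 2 * c_inf)) :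
  let lam := c_inf * dt / dx in
  let delta := dt / (2 * t_r) in
  let alpha := eps_s / eps_inf - 1 in
  von_neumann_stable (step_BxByEz lam delta alpha) /\
  von_neumann_stable (step_BzExEy lam delta alpha).
Proof.
move=> lam delta alpha.
have delta_gt0 : 0 < delta by rewrite divr_gt0// mulr_gt0.
have alpha_ge0 : 0 <= alpha by rewrite subr_ge0 ler_pdivlMr// mul1r.
have sqrt2_gt0 : 0 < Num.sqrt 2 :> R by rewrite sqrtr_gt0.
have lam_ge0 : 0 <= lam by rewrite divr_ge0 ?mulr_ge0// ltW.
(* With [s] equal to [8 * lam ^+ 2], s <= 4 amounts to sqrt 2 lam <= 1, and sqrt 2 lam is the ratio
   of [dt] to its bound dx / (sqrt 2 c_inf). *)
have lamE : 8 * lam ^+ 2 = 4 * (Num.sqrt 2 * lam) ^+ 2.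
  by rewrite [(Num.sqrt 2 * lam) ^+ 2]exprMn sqr_sqrtr//; ring.
have cfl_lhs : Num.sqrt 2 * lam = dt / (dx / (Num.sqrt 2 * c_inf)).
  by rewrite /lam; field; rewrite !gt_eqF.
have cfl_gt0 : 0 < dx / (Num.sqrt 2 * c_inf) by rewrite divr_gt0 ?mulr_gt0.
have l_ge0 : 0 <= Num.sqrt 2 * lam by rewrite mulr_ge0// ltW.
have cond : (0 < alpha /\ 8 * lam ^+ 2 <= 4 /\ delta <= 1) \/
    (alpha = 0 /\ 8 * lam ^+ 2 < 4).
  move: eps_le; rewrite le_eqVlt => /orP[/eqP eps_eq|eps_lt].
    right; split; first by rewrite /alpha -eps_eq divff ?subrr// gt_eqF.
    have : Num.sqrt 2 * lam < 1 by rewrite cfl_lhs ltr_pdivrMr// mul1r cond_ii.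
    by rewrite lamE; nra.
  left; have := cond_i eps_lt; rewrite le_min => /andP[cfl dt_le].
  split; first by rewrite subr_gt0 ltr_pdivlMr// mul1r.
  split; last by rewrite ler_pdivrMr ?mulr_gt0// mul1r.
  have : Num.sqrt 2 * lam <= 1 by rewrite cfl_lhs ler_pdivrMr// mul1r.
  by rewrite lamE; nra.
by split; [exact: stable_BxByEz | exact: stable_BzExEy].
Qed.
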